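(* For every integer $n\ge 1$, the third factorial moment of the area statistic on parking functions of length $n$ is $$\mathbb{E}\big[\mathrm{Area}(\mathrm{Area}-1)(\mathrm{Area}-2)\big]=-\frac{175}{192}n^{4}-\frac{283}{192}n^{3}+\frac{199}{192}n^{2}+\frac{259}{192}n+\left(\frac{15}{32}n^{3}+\frac{521}{96}n^{2}+\frac{1219}{96}n+\frac{743}{96}\right)E_1(n),$$ and asymptotically it equals $\frac{15}{128}\sqrt{2\pi}\, n^{9/2}+O(n^{4})$ as $n\to\infty$.
   Context: A parking function of length $n$ is a vector $(p_1,\dots,p_n)$ of positive integers such that its weakly increasing rearrangement $p_{(1)}\le p_{(2)}\le\dots\le p_{(n)}$ satisfies $p_{(i)}\le i$ for all $1\le i\le n$. There are $(n+1)^{n-1}$ of them. The area statistic is $\mathrm{Area}(p)=\frac{n(n+1)}{2}-\sum_{i=1}^n p_i$. Expectations are taken with respect to the uniform distribution on the set of parking functions of length $n$; the $k$-th factorial moment is $\mathbb{E}[\mathrm{Area}(\mathrm{Area}-1)\cdots(\mathrm{Area}-k+1)]$. Here $E_1(n)$ denotes $$E_1(n)= -\frac{n}{2}+\frac{1}{2}\,\frac{(n+1)!}{(n+1)^{n}}\sum_{k=0}^{n-1}\frac{(n+1)^k}{k!},$$ which is the expectation of the area statistic on parking functions of length $n$. *)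

(* Defs.v *)
From HB Require Import structures.
From mathcomp Require Import all_boot all_order all_algebra.
From mathcomp Require Import all_classical all_reals all_analysis.

Set Implicit Arguments.
Unset Strict Implicit.
Unset Printing Implicit Defensive.

Import Order.TTheory GRing.Theory Num.Theory.
Import numFieldNormedType.Exports.

Local Open Scope ring_scope.

(* The sorted sequence is indexed from 0, whence p_(i+1) <= i+1. *)
Definition parking_function (n : nat) (p : n.-tuple nat) : bool :=
  all (fun x => 0 < x)%N p &&
  [forall i : 'I_n, (nth 0%N (sort leq p) i <= i.+1)%N].

(* All entries of a parking function of length n are at most n, so storing
   them in 'I_n.+1 = {0, ..., n} loses none of them: see parking_functionsP. *)
Definition parking_functions (n : nat) : {set n.-tuple 'I_n.+1} :=
  [set p | parking_function (map_tuple (@nat_of_ord n.+1) p)].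

Lemma parking_functionsP (n : nat) (p : n.-tuple nat) :
  reflect (exists2 q, q \in parking_functions n
                    & p = map_tuple (@nat_of_ord n.+1) q)
          (parking_function p).
Proof.
apply: (iffP idP) => [pP|[q + ->]]; last by rewrite inE.
have le_pn x : x \in tval p -> (x <= n)%N.
  move: pP => /andP[_ /forallP pP].
  rewrite -(mem_sort leq) => /(nthP 0%N)[i + <-].
  rewrite size_sort size_tuple => ltin.
  exact: leq_trans (pP (Ordinal ltin)) ltin.
have eq_p : p = map_tuple (@nat_of_ord n.+1) (map_tuple (@inord n) p).
  apply/val_inj; rewrite /= -map_comp -[LHS]map_id.
  by apply/eq_in_map => x /le_pn lexn; rewrite /= inordK.
by exists (map_tuple (@inord n) p) => //; rewrite inE -eq_p.
Qed.

Definition parking_expectation (R : realType) (n : nat)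
    (X : n.-tuple 'I_n.+1 -> R) : R :=
  (\sum_(p in parking_functions n) X p) / #|parking_functions n|%:R.

Definition parking_area (R : realType) (n : nat) (p : n.-tuple 'I_n.+1) : R :=
  (n * n.+1)%:R / 2 - \sum_(i < n) (tnth p i)%:R.

Definition area_factorial_moment (R : realType) (n k : nat) : R :=
  parking_expectation
    (fun p : n.-tuple 'I_n.+1 => \prod_(j < k) (parking_area R p - j%:R)).

Definition E1 (R : realType) (n : nat) : R :=
  - (n%:R / 2) +
  1 / 2 * ((n.+1)`!%:R / n.+1%:R ^+ n) *
    \sum_(0 <= k < n) (n.+1%:R ^+ k / k`!%:R).

(* Main.v *)
Require Import Defs.
From HB Require Import structures.
From mathcomp Require Import all_boot all_order all_algebra.
From mathcomp Require Import all_classical all_reals all_analysis.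
From mathcomp Require Import ring lra zify.

Set Implicit Arguments.
Unset Strict Implicit.
Unset Printing Implicit Defensive.

Import Order.TTheory GRing.Theory Num.Theory.
Import numFieldNormedType.Exports.

Local Open Scope classical_set_scope.
Local Open Scope ring_scope.

(* Let an x-parking word of length n be a word s over {0, 1, ...} whose t-th
   smallest letter (t = 0, 1, ...) is less than x + t, and give it the weight
   a(x, s) = C(x + n, 2) - n - sum s; for x = 1 these are the parking functions
   (shifted by one) with their area.  Removing the k zeros of an
   (x+1)-parking word and lowering the other letters by one leaves an
   (x + k)-parking word, and the weight drops by exactly x.  So the sums G_j of
   the j-th falling factorials of the weight satisfy
     G_j(n, x) = sum_i C(j, i) (x - 1)_i (S G_(j-i))(n, x),
     (S f)(n, x) = sum_k C(n, k) f(n - k, x + k - 1).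
   The sums M_b(n, x) = sum_i [u^i](1 - u)^(-b) (n)_i (x + n)^(n - i) are
   eigenvectors of S for the eigenvalue 1, and Z : f |-> n f(n - 1, x + 1) maps
   M_b to M_b - M_(b-1) and satisfies S x = (x - 1 + Z) S.  Hence the recursion
   can be solved with G_j a linear combination of the x^a M_b.  At x = 1 every
   M_b reduces to M_1, that is to E_1(n), by a three-term recurrence.

   For the asymptotics, M_1(n, 1) / (n + 1)^n is the sum of the products
   q_i = prod_(j <= i) (1 - j / N), N = n + 1, and 0 <= sum_i (e_i - q_i) <= 4
   for e_i = exp (- i (i + 1) / (2 N)), while sum_i e_i is within O(1) of the
   Gaussian integral sqrt (pi N / 2). *)

(** * Abel sums and the binomial shift *)

(** Both sides count the pairs of a k-subset of n points and an injective sequence of i points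
    outside it. *)
Lemma mul_bin_ffact n k i :
  ('C(n, k) * (n - k) ^_ i = n ^_ i * 'C(n - i, k))%N.
Proof.
elim: i n => [|i IHi] n; first by rewrite muln1 mul1n subn0.
rewrite !ffactnS mulnA (mulnC 'C(_, _)) -mul_bin_down -mulnA.
have -> : (n - k).-1 = (n.-1 - k)%N by lia.
by rewrite IHi mulnA; congr (_ * 'C(_, _))%N; lia.
Qed.

Section Moments.
Variable R : comNzRingType.
Implicit Types (f g : nat -> R -> R) (n c : nat) (x y : R).

Definition binshift f n x : R :=
  \sum_(k < n.+1) 'C(n, k)%:R * f (n - k)%N (x + k%:R - 1).

Definition abel_sum (a : nat -> R) n x : R :=
  \sum_(i < n.+1) a i * (n ^_ i)%:R * (x + n%:R) ^+ (n - i).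

(** Terms with i > n vanish, so Abel sums for different n can share one range before summations are
    exchanged. *)
Lemma abel_sum_wide a m n x : (n < m)%N ->
  abel_sum a n x = \sum_(i < m) a i * (n ^_ i)%:R * (x + n%:R) ^+ (n - i).
Proof.
move=> ltnm; rewrite /abel_sum.
rewrite (big_ord_widen m
  (fun i => a i * (n ^_ i)%:R * (x + n%:R) ^+ (n - i))) //.
rewrite big_mkcond /=; apply: eq_bigr => i _; case: ltnP => // ltni.
by rewrite ffact_small // mulr0 mul0r.
Qed.

(** In the k-th summand (x + k - 1) + (n - k) = x + n - 1 does not depend on k. For fixed i,
    [mul_bin_ffact] extracts (n)_i and the binomial theorem sums the rest to (x + n)^(n - i),
    whatever the coefficients. *)
Lemma binshift_abel_sum a n x : binshift (abel_sum a) n x = abel_sum a n x.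
Proof.
rewrite /binshift.
transitivity (\sum_(k < n.+1) \sum_(i < n.+1)
   'C(n, k)%:R * (a i * ((n - k) ^_ i)%:R * (x + n%:R - 1) ^+ (n - k - i))).
  apply: eq_bigr => k _.
  rewrite (@abel_sum_wide _ n.+1) ?ltnS ?leq_subr // mulr_sumr.
  apply: eq_bigr => i _; congr (_ * (_ * _ ^+ _)).
  by rewrite natrB -1?ltnS //; ring.
rewrite exchange_big /=; apply: eq_bigr => i _.
have -> : x + n%:R = (x + n%:R - 1) + 1 by ring.
rewrite exprDn mulr_sumr addrK.
rewrite (big_ord_widen n.+1 (fun k => a i * (n ^_ i)%:R *
  ((x + n%:R - 1) ^+ (n - i - k) * 1 ^+ k *+ 'C(n - i, k))))
  ?ltnS ?leq_subr // [RHS]big_mkcond /=.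
apply: eq_bigr => k _; case: ltnP => [|ltk]; last first.
  rewrite ffact_small ?mulr0 ?mul0r ?mulr0 //.
  by have := ltn_ord k; have := ltn_ord i; lia.
rewrite ltnS => lek.
rewrite expr1n mulr1 subnAC -[in RHS]mulr_natr.
have E' : 'C(n, k)%:R * ((n - k) ^_ i)%:R = (n ^_ i)%:R * 'C(n - i, k)%:R :> R.
  by rewrite -!natrM mul_bin_ffact.
ring: E'.
Qed.

Lemma binshiftD f g n x :
  binshift (fun n x => f n x + g n x) n x = binshift f n x + binshift g n x.
Proof. by rewrite -big_split; apply: eq_bigr => k _; rewrite mulrDr. Qed.

Lemma binshiftZ a f n x :
  binshift (fun n x => a * f n x) n x = a * binshift f n x.
Proof. by rewrite mulr_sumr; apply: eq_bigr => k _; rewrite mulrCA. Qed.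

Lemma eq_binshift f g n x : (forall n x, f n x = g n x) ->
  binshift f n x = binshift g n x.
Proof. by move=> E; apply: eq_bigr => k _; rewrite E. Qed.

(** Write x + k - 1 = (x - 1) + k and use k C(n, k) = n C(n - 1, k - 1); this is S x = (x - 1 + Z)
    S. *)
Lemma binshift_mulX f n x :
  binshift (fun n x => x * f n x) n x =
  (x - 1) * binshift f n x + n%:R * binshift f n.-1 (x + 1).
Proof.
transitivity ((x - 1) * binshift f n x +
   \sum_(k < n.+1) (k * 'C(n, k))%:R * f (n - k)%N (x + k%:R - 1)).
  rewrite mulr_sumr -big_split; apply: eq_bigr => k _ /=.
  by rewrite natrM; ring.
congr (_ + _); rewrite big_ord_recl mul0n mul0r add0r mulr_sumr.
case: n => [|n]; first by rewrite big_ord0 big_ord1 mul0r.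
apply: eq_bigr => k _; rewrite /= /bump add1n -mul_bin_diag natrM mulrA.
by congr (_ * f _ _); rewrite -[k.+1]add1n natrD; ring.
Qed.

(* [(x - 1 + Z) ^ a] applied to [v c], where [Z] sends [v c] to
   [v c - v c.+1] and [Z x = (x + 1) Z]. *)
Fixpoint shift_monomial (a : nat) x (v : nat -> R) c : R :=
  if a is a'.+1 then
    (x - 1) * shift_monomial a' x v c +
    shift_monomial a' (x + 1) (fun c => v c - v c.+1) c
  else v c.

Lemma eq_shift_monomial a x v w c : v =1 w ->
  shift_monomial a x v c = shift_monomial a x w c.
Proof.
elim: a x v w c => [|a IHa] x v w c E //=.
by rewrite (IHa _ _ _ _ E); congr (_ + _); apply: IHa => d; rewrite !E.
Qed.

Lemma shift_monomialZ b a x v c :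
  shift_monomial a x (fun c => b * v c) c = b * shift_monomial a x v c.
Proof.
elim: a x v c => [|a IHa] x v c //=; rewrite IHa mulrDr mulrCA; congr (_ + _).
by rewrite -IHa; apply: eq_shift_monomial => d; rewrite mulrBr.
Qed.

Lemma binshift_monomial (M : nat -> nat -> R -> R) a c n x :
  (forall c n x, binshift (M c) n x = M c n x) ->
  (forall c n x, n%:R * M c n.-1 (x + 1) = M c n x - M c.+1 n x) ->
  binshift (fun n x => x ^+ a * M c n x) n x =
  shift_monomial a x (fun c => M c n x) c.
Proof.
move=> MS MZ; elim: a n x => [|a IHa] n x.
  by rewrite -[RHS]MS; apply: eq_binshift => m y; rewrite mul1r.
rewrite (eq_binshift (g := fun n x => x * (x ^+ a * M c n x))); last first.
  by move=> m y; rewrite exprS mulrA.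
rewrite binshift_mulX !IHa /=; congr (_ + _); rewrite -shift_monomialZ.
by apply: eq_shift_monomial => d; exact: MZ.
Qed.

(* Coefficient of [u ^ i] in [(1 - u) ^ (c - 7)]; thus [moment c] below is M_b
   with b = 7 - c. *)
Fixpoint negbin_coef (c i : nat) : R :=
  if c is c'.+1 then
    negbin_coef c' i - (if i is i'.+1 then negbin_coef c' i' else 0)
  else 'C(i + 6, 6)%:R.

Definition moment c := abel_sum (negbin_coef c).

(** The difference of the two moments has the coefficients of [moment c] delayed by one index, and n
    (n - 1)_i = (n)_(i+1). *)
Lemma moment_shift c n x :
  n%:R * moment c n.-1 (x + 1) = moment c n x - moment c.+1 n x.
Proof.
rewrite /moment /abel_sum -sumrB [RHS]big_ord_recl /= subr0 subrr add0r.
rewrite mulr_sumr; case: n => [|n]; first by rewrite big_ord0 big_ord1 mul0r.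
apply: eq_bigr => i _; rewrite /= /bump add1n subSS ffactnS natrM /=.
have -> : x + 1 + n%:R = x + n.+1%:R by rewrite -natr1; ring.
rewrite add0n; ring.
Qed.

(* [mono k a c] stands for [k * x ^ a * moment c n x]. *)
Definition mono (k : int) (a c : nat) := (k, a, c).

Definition expansion (l : seq (int * nat * nat)) x (v : nat -> R) : R :=
  \sum_(t <- l) t.1.1%:~R * (x ^+ t.1.2 * v t.2).

Definition shift_expansion (l : seq (int * nat * nat)) x (v : nat -> R) : R :=
  \sum_(t <- l) t.1.1%:~R * shift_monomial t.1.2 x v t.2.

Lemma binshift_expansion l n x :
  binshift (fun n x => expansion l x (fun c => moment c n x)) n x =
  shift_expansion l x (fun c => moment c n x).
Proof.
rewrite /shift_expansion; elim: l => [|t l IHl].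
  rewrite big_nil /binshift big1 // => k _.
  by rewrite /expansion big_nil mulr0.
rewrite big_cons -IHl -(@binshift_monomial moment) //.
- rewrite -binshiftZ -binshiftD; apply: eq_binshift => m y.
  by rewrite /expansion big_cons.
- by move=> *; exact: binshift_abel_sum.
- exact: moment_shift.
Qed.

(* The terms of G_0, 2 G_1, 12 G_2 and 8 G_3.  For j > 0, the coefficients are
   obtained by solving the linear system that the recursion imposes on the
   products [x ^ a * moment c n x] with a > 0, so that G_j(n, 0) = 0. *)
Definition area_terms0 : seq (int * nat * nat) :=
  [:: mono 1 0 8].
Definition area_terms1 : seq (int * nat * nat) :=
  [:: mono 1 1 8; mono (-3) 1 7; mono 1 1 6; mono 1 2 7].
Definition area_terms2 : seq (int * nat * nat) :=
  [:: mono (-5) 1 8; mono 17 1 7; mono (-32) 1 6; mono 64 1 5; mono (-53) 1 4;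
      mono 15 1 3; mono 3 2 8; mono (-24) 2 7; mono 51 2 6; mono (-48) 2 5;
      mono 15 2 4; mono 6 3 7; mono (-22) 3 6; mono 10 3 5; mono 3 4 6].
Definition area_terms3 : seq (int * nat * nat) :=
  [:: mono 6 1 8; mono (-22) 1 7; mono 57 1 6; mono (-171) 1 5; mono 398 1 4;
      mono (-708) 1 3; mono 757 1 2; mono (-415) 1 1; mono 90 1 0;
      mono (-5) 2 8; mono 40 2 7; mono (-123) 2 6; mono 288 2 5;
      mono (-545) 2 4; mono 642 2 3; mono (-385) 2 2; mono 90 2 1; mono 1 3 8;
      mono (-20) 3 7; mono 91 3 6; mono (-199) 3 5; mono 298 3 4;
      mono (-220) 3 3; mono 60 3 2; mono 3 4 7; mono (-28) 4 6; mono 71 4 5;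
      mono (-74) 4 4; mono 25 4 3; mono 3 5 6; mono (-13) 5 5; mono 7 5 4;
      mono 1 6 5].

(** This lemma and the next three are the recursions for G_0, ..., G_3 multiplied by 1, 2, 12 and
    24. The moments are replaced by a free function v, so each is a polynomial identity in x and
    finitely many values of v. *)
Lemma area_terms0_rec x v :
  expansion area_terms0 x v = shift_expansion area_terms0 x v.
Proof. rewrite /expansion /shift_expansion !unlock /=; ring. Qed.

Lemma area_terms1_rec x v :
  expansion area_terms1 x v =
  shift_expansion area_terms1 x v
  + 2%:R * (x - 1) * shift_expansion area_terms0 x v.
Proof. rewrite /expansion /shift_expansion !unlock /=; ring. Qed.

Lemma area_terms2_rec x v :
  expansion area_terms2 x v =
  shift_expansion area_terms2 x v
  + 12%:R * (x - 1) * shift_expansion area_terms1 x v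
  + 12%:R * (x - 1) * (x - 2%:R) * shift_expansion area_terms0 x v.
Proof. rewrite /expansion /shift_expansion !unlock /=; ring. Qed.

Lemma area_terms3_rec x v :
  3%:R * expansion area_terms3 x v =
  3%:R * shift_expansion area_terms3 x v
  + 6%:R * (x - 1) * shift_expansion area_terms2 x v
  + 36%:R * (x - 1) * (x - 2%:R) * shift_expansion area_terms1 x v
  + 24%:R * (x - 1) * (x - 2%:R) * (x - 3%:R) * shift_expansion area_terms0 x v.
Proof. rewrite /expansion /shift_expansion !unlock /=; ring. Qed.

(** * Closed forms of the moments and their three-term recurrence *)

Lemma abel_sum_mul a n x :
  n%:R * abel_sum a n x =
  abel_sum (fun i => i%:R * a i) n x
  + (x + n%:R) * abel_sum (fun i => if i is i'.+1 then a i' else 0) n x.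
Proof.
rewrite /abel_sum [X in _ = _ + _ * X]big_ord_recl !mul0r add0r.
(* Split n = i + (n - i) in each term; since (n - i) (n)_i = (n)_(i+1), the second part moves to
   index i + 1. At i = n it is absent. *)
rewrite !mulr_sumr [LHS]big_ord_recr [X in _ = X + _]big_ord_recr /=.
rewrite addrAC -big_split /= !mulrA; congr (_ + _); apply: eq_bigr => i _.
rewrite /bump add1n add0n.
rewrite ffactnSr natrM natrB 1?ltnW // (_ : n - i = (n - i.+1).+1)%N; last first.
  by have := ltn_ord i; lia.
rewrite exprS; ring.
Qed.

Lemma negbin_coefE c i : (c <= 6)%N ->
  negbin_coef c i = 'C(i + (6 - c), 6 - c)%:R.
Proof.
elim: c i => [|c IHc] i ltc //=; rewrite IHc; last exact: ltnW.
case: i => [|i]; first by rewrite !add0n !binn subr0.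
rewrite IHc; last exact: ltnW.
rewrite (_ : 6 - c = (6 - c.+1).+1)%N; last by lia.
by rewrite addSn binS natrD addrAC subrr add0r addSnnS.
Qed.

Lemma negbin_coef7 i : negbin_coef 7 i = (i == 0%N)%:R.
Proof.
rewrite -[LHS]/(negbin_coef 6 i - if i is i'.+1 then negbin_coef 6 i' else 0).
rewrite negbin_coefE // bin0; case: i => [|i]; first by rewrite subr0.
by rewrite negbin_coefE // bin0 subrr.
Qed.

Lemma moment7 n x : moment 7 n x = (x + n%:R) ^+ n.
Proof.
rewrite /moment /abel_sum big_ord_recl big1 => [|i _].
  by rewrite negbin_coef7 addr0 !mul1r subn0.
by rewrite negbin_coef7 !mul0r.
Qed.

(** This is M_(-1), equal to x (x + n)^(n - 1) for n > 0: the number of x-parking words. *)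
Lemma moment8 n x :
  moment 8 n x = (x + n%:R) ^+ n - n%:R * (x + n%:R) ^+ n.-1.
Proof.
have := moment_shift 7 n x; rewrite !moment7.
case: n => [|n] /=.
  by rewrite !mul0r => /eqP; rewrite eq_sym subr_eq0 => /eqP <-; rewrite subr0.
have -> : x + 1 + n%:R = x + n.+1%:R by rewrite -natr1; ring.
move=> ->; ring.
Qed.

(** Since u d/du (1 - u)^(-b) = b ((1 - u)^(-b-1) - (1 - u)^(-b)), [abel_sum_mul] reads n M_b = b
    (M_(b+1) - M_b) + (x + n) (M_b - M_(b-1)). *)
Lemma moment_three_term b n x : (0 < b <= 6)%N ->
  b%:R * moment (6 - b) n x =
  (b%:R - x) * moment (7 - b) n x + (x + n%:R) * moment (8 - b) n x.
Proof.
case: b => [//|d] /= d6.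
have E c : abel_sum (fun i => if i is i'.+1 then negbin_coef c i' else 0) n x =
    moment c n x - moment c.+1 n x.
  rewrite /moment /abel_sum -sumrB; apply: eq_bigr => i _.
  by case: i => [[|i] ?] /=; ring.
have := abel_sum_mul (negbin_coef (7 - d.+1)) n x; rewrite E -/(moment _ _ _).
have -> : abel_sum (fun i => i%:R * negbin_coef (7 - d.+1) i) n x =
    d.+1%:R * (moment (6 - d.+1) n x - moment (7 - d.+1) n x).
  rewrite /moment /abel_sum -sumrB mulr_sumr; apply: eq_bigr => i _.
  rewrite !negbin_coefE; [|lia|lia].
  have -> : (6 - (7 - d.+1) = d)%N by lia.
  have -> : (6 - (6 - d.+1) = d.+1)%N by lia.
  have := mul_bin_left (i + d) d; rewrite addnK => /(congr1 (fun k => k%:R : R)).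
  rewrite addnS binS (natrD _ 'C(_, _)) !natrM => F; rewrite -F; ring.
have -> : ((7 - d.+1).+1 = 8 - d.+1)%N by lia.
move=> F.
have -> : (d.+1%:R - x) * moment (7 - d.+1) n x
    + (x + n%:R) * moment (8 - d.+1) n x =
    n%:R * moment (7 - d.+1) n x + d.+1%:R * moment (7 - d.+1) n x
    - (x + n%:R) * (moment (7 - d.+1) n x - moment (8 - d.+1) n x) by ring.
rewrite F; ring.
Qed.

Lemma moment6 n x :
  moment 6 n x = \sum_(i < n.+1) (n ^_ i)%:R * (x + n%:R) ^+ (n - i).
Proof. by apply: eq_bigr => i _; rewrite negbin_coefE // bin0 mul1r. Qed.

End Moments.

(** * Parking words *)

Section WordSum.
Variable R : comNzRingType.
Implicit Types (Phi Psi : seq nat -> R) (n m k : nat) (s : seq nat).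

(** Words are plain sequences, so that deleting their zeros may change the length freely. *)
Fixpoint word_sum n m Phi : R :=
  if n is n'.+1 then \sum_(v < m) word_sum n' m (fun s => Phi (val v :: s))
  else Phi [::].

Lemma eq_word_sum n m Phi Psi :
  (forall s, size s = n -> Phi s = Psi s) ->
  word_sum n m Phi = word_sum n m Psi.
Proof.
elim: n Phi Psi => [|n IHn] Phi Psi E /=; first exact: E.
by apply: eq_bigr => v _; apply: IHn => s sz; apply: E; rewrite /= sz.
Qed.

Lemma word_sumD n m Phi Psi :
  word_sum n m (fun s => Phi s + Psi s) = word_sum n m Phi + word_sum n m Psi.
Proof.
elim: n Phi Psi => [|n IHn] Phi Psi //=.
by rewrite -big_split; apply: eq_bigr => v _; rewrite IHn.
Qed.

Lemma word_sumZ a n m Phi :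
  word_sum n m (fun s => a * Phi s) = a * word_sum n m Phi.
Proof.
elim: n Phi => [|n IHn] Phi //=.
by rewrite mulr_sumr; apply: eq_bigr => v _; rewrite IHn.
Qed.

Lemma word_sum_sum j n m (Phi : nat -> seq nat -> R) :
  word_sum n m (fun s => \sum_(i < j) Phi i s) =
  \sum_(i < j) word_sum n m (Phi i).
Proof.
elim: j => [|j IHj].
  rewrite big_ord0 -[RHS](mul0r (word_sum n m (fun=> 0))) -word_sumZ.
  by apply: eq_word_sum => s _; rewrite big_ord0 mul0r.
rewrite big_ord_recr /= -IHj -word_sumD.
by apply: eq_word_sum => s _; rewrite big_ord_recr.
Qed.

Lemma tuple_word_sum n m Phi :
  \sum_(t : n.-tuple 'I_m) Phi (map val t) = word_sum n m Phi.
Proof.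
elim: n Phi => [|n IHn] Phi /=.
  by rewrite (big_pred1 [tuple]) // => t; rewrite [t]tuple0; apply/esym/eqP.
rewrite (reindex (fun p : 'I_m * n.-tuple 'I_m => [tuple of p.1 :: p.2])) /=.
  rewrite -(pair_big xpredT xpredT
    (fun v (t : n.-tuple 'I_m) => Phi (val v :: map val t))) /=.
  by apply: eq_bigr => v _; rewrite -IHn.
exists (fun t => (thead t, [tuple of behead t])) => t _.
  by case: t => v t /=; congr (_, _); apply/val_inj.
by rewrite [RHS]tuple_eta.
Qed.

Definition strip s := [seq v.-1 | v <- s & v != 0%N].

(** C(n, k) counts the positions of the k zeros. The induction separates a zero first letter from a
    positive one and recombines by Pascal's rule. *)
Lemma word_sum_strip n m (Phi : nat -> seq nat -> R) :
  word_sum n m.+1 (fun s => Phi (count_mem 0%N s) (strip s)) =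
  \sum_(k < n.+1) 'C(n, k)%:R * word_sum (n - k) m (Phi k).
Proof.
elim: n Phi => [|n IHn] Phi; first by rewrite big_ord1 bin0 mul1r.
rewrite /= big_ord_recl /=.
rewrite (IHn (fun k => Phi k.+1)).
transitivity (\sum_(k < n.+1) 'C(n, k)%:R * word_sum (n - k) m (Phi k.+1) +
  \sum_(k < n.+1) 'C(n, k)%:R * word_sum (n - k).+1 m (Phi k)).
  congr (_ + _).
  under eq_bigr => v _ do
    rewrite (IHn (fun k s => Phi k (val v :: s))).
  by rewrite exchange_big; apply: eq_bigr => k _; rewrite -mulr_sumr.
rewrite [RHS]big_ord_recl [X in _ + X]big_ord_recl !bin0 !subn0 !mul1r addrCA.
congr (_ + _).
under [in RHS]eq_bigr => k _.
  rewrite lift0 binS subSS addnC natrD mulrDl; over.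
rewrite big_split /=; congr (_ + _).
rewrite [RHS]big_ord_recr /= bin_small // mul0r addr0.
by apply: eq_bigr => k _; rewrite /bump /= add1n -[in RHS]subnSK.
Qed.

End WordSum.

Definition parking_word x (s : seq nat) : bool :=
  all (fun t => t < count (fun v => v < x + t)%N s)%N (iota 0 (size s)).

Lemma strip_count t (s : seq nat) :
  count (fun v => v < t.+1)%N s =
  (count_mem 0%N s + count (fun v => v < t)%N (strip s))%N.
Proof. elim: s => [|[|v] s IHs] //=; rewrite IHs /strip /= ; lia. Qed.

Lemma size_strip (s : seq nat) : size s = (count_mem 0%N s + size (strip s))%N.
Proof. elim: s => [|[|v] s IHs] //=; rewrite IHs /strip /= ; lia. Qed.

Lemma sumn_strip (s : seq nat) : sumn s = (size (strip s) + sumn (strip s))%N.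
Proof. elim: s => [|[|v] s IHs] //=; rewrite IHs /strip /= ; lia. Qed.

Lemma parking_wordP x (s : seq nat) :
  reflect (forall t, t < size s -> t < count (fun v => v < x + t)%N s)%N
          (parking_word x s).
Proof.
apply: (iffP allP) => H t; last by rewrite mem_iota => /H.
by move=> lt; apply: H; rewrite mem_iota.
Qed.

Lemma parking_word0 (s : seq nat) : parking_word 0 s = (s == [::]).
Proof.
case: s => [//|v s]; apply/negbTE/parking_wordP => /(_ 0%N isT).
by rewrite addn0 (@eq_count _ _ pred0) ?count_pred0.
Qed.

(** With k zeros, the conditions for t < k hold because of the zeros alone; the condition for k + t
    is the one for t on the stripped word. *)
Lemma parking_word_strip x (s : seq nat) :
  parking_word x.+1 s = parking_word (x + count_mem 0%N s) (strip s).
Proof.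
apply/parking_wordP/parking_wordP => H t lt.
  have := H (count_mem 0%N s + t)%N; rewrite size_strip ltn_add2l => /(_ lt).
  by rewrite addSn strip_count ltn_add2l addnA.
rewrite addSn strip_count.
have [lt0|le0] := ltnP t (count_mem 0%N s); first exact: ltn_addr.
have := H (t - count_mem 0%N s)%N; rewrite -addnA subnKC // => H'.
by rewrite -ltn_subLR // H' // ltn_subLR // -size_strip.
Qed.

Definition falling {R : comNzRingType} (u : R) j : R := \prod_(i < j) (u - i%:R).

(** Vandermonde's identity: the new factor u + v - j splits as (u - i) + (v - (j - i)), and Pascal's
    rule collects both sums. *)
Lemma fallingD {R : comNzRingType} (u v : R) j :
  falling (u + v) j =
  \sum_(i < j.+1) 'C(j, i)%:R * falling u i * falling v (j - i).
Proof.
elim: j => [|j IHj].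
  by rewrite big_ord1 /falling !big_ord0 bin0 !mul1r.
have fS (w : R) i : falling w i.+1 = falling w i * (w - i%:R).
  by rewrite /falling big_ord_recr.
rewrite fS IHj mulr_suml.
transitivity (\sum_(i < j.+1) ('C(j, i)%:R * falling u i.+1 * falling v (j - i)
    + 'C(j, i)%:R * falling u i * falling v (j - i).+1)).
  apply: eq_bigr => i _; rewrite !fS natrB; last by rewrite -ltnS.
  ring.
rewrite big_split /=.
rewrite [X in _ + X]big_ord_recl [RHS]big_ord_recl !bin0 !subn0 addrCA.
congr (_ + _).
under [in RHS]eq_bigr => i _.
  rewrite lift0 binS subSS addnC natrD mulrDl mulrDl; over.
rewrite big_split /=; congr (_ + _).
rewrite [RHS]big_ord_recr /= bin_small // !mul0r addr0.
by apply: eq_bigr => i _; rewrite /bump /= add1n -subSn // subSS.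
Qed.

(** * Factorial moments of the weight over x-parking words *)

Section AreaMoments.
Variable R : realFieldType.
Implicit Types (s : seq nat) (x n m j : nat).

Definition word_area x s : R :=
  'C(x + size s, 2)%:R - (size s)%:R - (sumn s)%:R.

Lemma word_area_strip x s :
  word_area x.+1 s = x%:R + word_area (x + count_mem 0%N s) (strip s).
Proof.
rewrite /word_area addSn binS bin1 -addnA -size_strip sumn_strip !natrD.
ring.
Qed.

Definition word_moment j n x m : R :=
  word_sum n m (fun s => (parking_word x s)%:R * falling (word_area x s) j).

Lemma word_moment_strip j n x m :
  word_moment j n x.+1 m.+1 =
  \sum_(i < j.+1) 'C(j, i)%:R * falling (x%:R : R) i *
     \sum_(k < n.+1) 'C(n, k)%:R * word_moment (j - i) (n - k) (x + k) m.
Proof.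
pose Phi k s : R := (parking_word (x + k) s)%:R *
  falling (x%:R + word_area (x + k) s) j.
rewrite /word_moment (eq_word_sum _
  (Psi := fun s => Phi (count_mem 0%N s) (strip s))).
  rewrite word_sum_strip; under [RHS]eq_bigr => i _ do rewrite mulr_sumr.
  rewrite exchange_big; apply: eq_bigr => k _ /=.
  pose term i s := 'C(j, i)%:R * falling (x%:R : R) i *
    ((parking_word (x + k) s)%:R * falling (word_area (x + k) s) (j - i)).
  rewrite (eq_word_sum _ (Psi := fun s => \sum_(i < j.+1) term i s)).
    rewrite (word_sum_sum _ _ _ term) mulr_sumr; apply: eq_bigr => i _.
    by rewrite word_sumZ mulrCA.
  move=> s _; rewrite /Phi fallingD mulr_sumr; apply: eq_bigr => i _.
  rewrite /term.
  ring.
by move=> s _; rewrite /Phi parking_word_strip word_area_strip.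
Qed.

Definition moment_expansion j : seq (int * nat * nat) :=
  nth [::] [:: area_terms0; area_terms1; area_terms2; area_terms3] j.

Definition area_moment j n (x : R) : R :=
  expansion (moment_expansion j) x (fun c => moment c n x)
  / (nth 1 [:: 1; 2%:R; 12%:R; 8%:R] j).

Lemma binshift_area_moment j n (x : R) :
  binshift (area_moment j) n x =
  shift_expansion (moment_expansion j) x (fun c => moment c n x)
  / (nth 1 [:: 1; 2%:R; 12%:R; 8%:R] j).
Proof.
rewrite -binshift_expansion mulrC -binshiftZ.
by apply: eq_binshift => m y; rewrite mulrC.
Qed.

Lemma area_moment_rec j n (x : R) : (j < 4)%N ->
  area_moment j n x =
  \sum_(i < j.+1) 'C(j, i)%:R * falling (x - 1) i *
    binshift (area_moment (j - i)) n x.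
Proof.
under eq_bigr => i _ do rewrite binshift_area_moment.
rewrite /area_moment /moment_expansion; move: (fun c => moment c n x) => v.
case: j => [|[|[|[|j]]]] //= _; rewrite !big_ord_recl big_ord0 /falling /= /bump /= ?addn0;
  rewrite ?big_ord_recl ?big_ord0 /= /bump /= ?add1n ?add0n ?addn0 ?subn0 ?bin0 ?bin1 ?binn //.
- by rewrite area_terms0_rec; field.
- by rewrite area_terms1_rec; field.
- by rewrite area_terms2_rec; field.
- have E : expansion area_terms3 x v = (3%:R * expansion area_terms3 x v) / 3%:R by field.
  by rewrite E area_terms3_rec (_ : 'C(3, 2) = 3%N) //; field.
Qed.

(** Only the empty word is 0-parking, with weight 0. On the right, every monomial for j > 0 contains
    x, and M_(-1)(n, 0) = 0 for n > 0. *)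
Lemma word_momentE0 j n m : (j < 4)%N ->
  word_moment j n 0 m = area_moment j n 0.
Proof.
move=> j4.
transitivity (((n == 0%N) && (j == 0%N))%:R : R).
  case: n => [|n].
    rewrite /word_moment /= /word_area /= bin0n /= !subr0 /falling mul1r.
    case: j j4 => [|j] _ /=; first by rewrite big_ord0.
    by rewrite big_ord_recl subr0 mul0r.
  rewrite /word_moment (eq_word_sum _
  (Psi := fun s => 0 * 1)).
    by rewrite word_sumZ mul0r.
  by move=> [|v s] // _; rewrite parking_word0 !mul0r.
case: j j4 => [|[|[|[|j]]]] //= _; rewrite /area_moment /expansion !unlock /= ?andbF ?andbT.
- rewrite moment8 !add0r; case: n => [|n] /=; first by rewrite mul0r; field.
  by rewrite -exprS subrr; field.
- by rewrite mulr0n; field.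
- by rewrite mulr0n; field.
- by rewrite mulr0n; field.
Qed.

Lemma word_moment_step n x m j : (j < 4)%N ->
  (forall k i, (k <= n)%N -> (i < 4)%N ->
     word_moment i (n - k) (x + k) m = area_moment i (n - k) (x + k)%:R) ->
  word_moment j n x.+1 m.+1 = area_moment j n x.+1%:R.
Proof.
move=> j4 H; rewrite word_moment_strip area_moment_rec // -natr1 addrK.
apply: eq_bigr => i _; congr (_ * _); apply: eq_bigr => k _.
rewrite H; [|by rewrite -ltnS|exact: leq_ltn_trans (leq_subr _ _) j4].
by congr (_ * area_moment _ _ _); rewrite natrD; ring.
Qed.

(** Letters of an x-parking word of length n > 0 are below x + n - 1, so the bound m loses no word.
    Stripping k zeros lowers m by one and takes (n, x + 1) to (n - k, x + k), preserving the
    hypothesis. *)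
Lemma word_momentE j n x m : (j < 4)%N -> (x + n <= m.+1)%N ->
  word_moment j n x m = area_moment j n x%:R.
Proof.
elim: m j n x => [|m IHm] j n [|x] j4 le; try exact: word_momentE0.
  have -> : n = 0%N by lia.
  have -> : x = 0%N by lia.
  (* The empty word does not see the letter bound; the bound 1 makes [word_moment_step]
     applicable. *)
  rewrite -[LHS]/(word_moment j 0 1 1).
  by apply: word_moment_step => // [] [|k] i // _ i4; exact: word_momentE0.
by apply: word_moment_step => // k i lek i4; apply: IHm => //; lia.
Qed.

End AreaMoments.

(** * The exact formula *)

(** After sorting, the entries at most v form an initial segment. *)
Lemma sorted_nth_leq (s : seq nat) i v : (i < size s)%N ->
  (nth 0%N (sort leq s) i <= v)%N = (i < count (fun x => x <= v) s)%N.
Proof.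
move=> lti; have ss : sorted leq (sort leq s) by exact/sort_sorted/leq_total.
have -> : count (fun x => x <= v)%N s = count (fun x => x <= v)%N (sort leq s).
  by apply/esym/permP; exact: permEl (perm_sort _ _).
apply/idP/idP => [|lt]; last exact: (@nth_count_le _ nat).
rewrite leqNgt; apply: contraR; rewrite -leqNgt => le.
by apply: (@nth_count_gt _ nat) => //; rewrite size_sort le.
Qed.

Lemma parking_function_strip n (p : n.-tuple nat) :
  parking_function p = (count_mem 0%N p == 0%N) && parking_word 1 (strip p).
Proof.
rewrite /parking_function; set s := tval p.
have -> : all (fun x => 0 < x)%N s = (count_mem 0%N s == 0%N).
  by rewrite eqn0Ngt -has_count -all_predC; apply: eq_all => x; rewrite /= lt0n.
case: eqP => //= c0.
have szs : size (strip s) = n by rewrite -[RHS](size_tuple p) [RHS]size_strip c0.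
(* For t >= n, [nth] returns its default 0 and the equality fails, whence the second alternative. *)
have E t :
  (nth 0%N (sort leq s) t <= t.+1)%N =
    (t < count (fun v => v < 1 + t)%N (strip s))%N \/ ~ (t < n)%N.
  have [lt|le] := ltnP t n; last by right.
  by left; rewrite sorted_nth_leq ?size_tuple // strip_count c0.
apply/forallP/parking_wordP => [H t|H i].
  by rewrite szs => lt; case: (E t) => // <-; exact: (H (Ordinal lt)).
case: (E i) => [-> |/negP]; last by rewrite ltn_ord.
by apply: H; rewrite szs.
Qed.

Section Exact.
Variable R : realType.

(** [Psi] vanishes on words containing a zero, so only k = 0 survives in [word_sum_strip], where
    stripping lowers every entry by one and turns the area into the weight for x = 1. *)
Lemma sum_parking_falling n j : (j < 4)%N ->
  \sum_(p in parking_functions n) falling (parking_area R p) j =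
  area_moment j n (1 : R).
Proof.
move=> j4; rewrite -[X in area_moment _ _ X]/(1%:R) -(@word_momentE R j n 1 n) //.
pose Psi k s : R := (k == 0%N)%:R *
  ((parking_word 1 s)%:R * falling (word_area R 1 s) j).
transitivity (word_sum n n.+1 (fun s => Psi (count_mem 0%N s) (strip s))).
  rewrite -tuple_word_sum big_mkcond; apply: eq_bigr => p _.
  rewrite inE parking_function_strip /Psi /=.
  set s := map _ _.
  case: eqP => [c0|_]; last by rewrite mul0r.
  case: parking_word; last by rewrite mul0r mulr0.
  rewrite !mul1r; congr falling; rewrite /parking_area.
  have sz : size s = n by rewrite size_map size_tuple.
  have szs : size (strip s) = n by rewrite -[RHS]sz [RHS]size_strip c0.
  have -> : \sum_(i < n) (tnth p i)%:R = (sumn s)%:R :> R.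
    by rewrite sumnE big_map big_tuple natr_sum.
  rewrite /word_area szs sumn_strip szs natrD.
  have := mul_bin_diag n.+1 1; rewrite bin1 => /(congr1 (fun k => k%:R : R)).
  rewrite !natrM => E.
  have -> : n%:R * n.+1%:R / 2 = 'C(1 + n, 2)%:R :> R.
    by rewrite add1n mulrC [_%:R * n.+1%:R]mulrC E mulKf.
  ring.
rewrite word_sum_strip big_ord_recl bin0 mul1r subn0 big1 ?addr0 => [|k _].
  by apply: eq_word_sum => s _; rewrite /Psi mul1r.
by rewrite /Psi word_sumZ !mul0r mulr0.
Qed.

(** The i = 0 term of M_1(n, 1) is (n + 1)^n. In the others, k = n - i and (n)_i = n! / k! give the
    sum in [E1]. *)
Lemma moment6_E1 n : (0 < n)%N ->
  moment 6 n 1 = n.+1%:R ^+ n.-1 * (2 * E1 R n + n%:R + n.+1%:R).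
Proof.
case: n => // n _ /=.
rewrite moment6 big_ord_recl /= subn0 mul1r nat1r.
rewrite /E1.
have -> : \sum_(i < n.+1) (n.+1 ^_ bump 0 i)%:R * (n.+2%:R : R) ^+ (n.+1 - bump 0 i) =
  (n.+1)`!%:R * \sum_(0 <= k < n.+1) (n.+2%:R ^+ k / k`!%:R).
  rewrite mulr_sumr big_mkord (reindex_inj rev_ord_inj) /=.
  apply: eq_bigr => i _; rewrite /bump add1n subSS.
  have lei : (i <= n)%N by rewrite -ltnS.
  rewrite subSS; have -> : (n - (n - i) = i)%N by lia.
  have -> : (n - i).+1 = (n.+1 - i)%N by lia.
  rewrite mulrCA mulrC; congr (_ * _).
  have i0 : i`!%:R != 0 :> R by rewrite pnatr_eq0 -lt0n fact_gt0.
  apply: (mulIf i0); rewrite -mulrA mulVf // mulr1 -natrM.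
  by rewrite -[in i`!](subKn (ltnW (ltn_ord i))) ffact_fact // leq_subr.
move: (\sum_(_ <= _ < _) _) => S.
rewrite (factS n.+1) natrM exprS.
have : n.+2%:R != 0 :> R by [].
have : n.+2%:R ^+ n != 0 :> R by rewrite expf_neq0.
rewrite -(natr1 n.+1); move: (n.+1%:R : R) => N.
move: ((N + 1) ^+ n) => P P0 N0.
by field; rewrite P0.
Qed.

Lemma area_factorial_moment3 n : (0 < n)%N ->
  area_factorial_moment R n 3 =
       - (175 / 192) * n%:R ^+ 4 - 283 / 192 * n%:R ^+ 3
       + 199 / 192 * n%:R ^+ 2 + 259 / 192 * n%:R
       + (15 / 32 * n%:R ^+ 3 + 521 / 96 * n%:R ^+ 2
          + 1219 / 96 * n%:R + 743 / 96) * E1 R n.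
Proof.
move=> n0; rewrite /area_factorial_moment /parking_expectation.
have -> : #|parking_functions n|%:R = area_moment 0 n (1 : R).
  rewrite -sum_parking_falling // -sumr_const.
  by apply: eq_bigr => p _; rewrite /falling big_ord0.
rewrite (sum_parking_falling n (isT : 3 < 4)%N).
rewrite /area_moment /expansion !unlock /=.
have m7 : moment 7 n (1 : R) = n.+1%:R * n.+1%:R ^+ n.-1.
  by rewrite moment7 nat1r -exprS prednK.
have m8 : moment 8 n (1 : R) = n.+1%:R ^+ n.-1.
  by rewrite moment8 -moment7 m7 nat1r -mulrBl -natrB // subSnn mul1r.
have m6 := moment6_E1 n0.
(* At x = 1 the recurrence for b = 1, ..., 6 reduces M_2, ..., M_7 to M_1, M_0 and M_(-1), all
   multiples of p = (n + 1)^(n - 1), which cancels in the quotient. For b = 1 the coefficient b - x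
   is zero. *)
have := moment_three_term n (1 : R) (isT : 0 < 1 <= 6)%N.
have := moment_three_term n (1 : R) (isT : 0 < 2 <= 6)%N.
have := moment_three_term n (1 : R) (isT : 0 < 3 <= 6)%N.
have := moment_three_term n (1 : R) (isT : 0 < 4 <= 6)%N.
have := moment_three_term n (1 : R) (isT : 0 < 5 <= 6)%N.
have := moment_three_term n (1 : R) (isT : 0 < 6 <= 6)%N.
rewrite ![(_ - _)%N]/= m6 m7 m8.
have : n.+1%:R ^+ n.-1 != 0 :> R by rewrite expf_neq0.
move: (E1 R n) (n.+1%:R ^+ n.-1) (moment 0 n 1) (moment 1 n 1) (moment 2 n 1)
  (moment 3 n 1) (moment 4 n 1) (moment 5 n 1) => e p v0 v1 v2 v3 v4 v5 p0.
rewrite -(natr1 n); move: (n%:R : R) => N.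
move=> e6 e5 e4 e3 e2 e1.
have {}e1 : v5 = (1 + N) * ((N + 1) * p) by lra.
have {}e2 : v4 = (v5 + (1 + N) * (p * (2 * e + N + (N + 1)))) / 2 by lra.
have {}e3 : v3 = (2 * v4 + (1 + N) * v5) / 3 by lra.
have {}e4 : v2 = (3 * v3 + (1 + N) * v4) / 4 by lra.
have {}e5 : v1 = (4 * v2 + (1 + N) * v3) / 5 by lra.
have {}e6 : v0 = (5 * v1 + (1 + N) * v2) / 6 by lra.
rewrite e6 e5 e4 e3 e2 e1.
by field.
Qed.
End Exact.

(** * Comparison of Ramanujan's sum with a Gaussian sum *)

Section RamanujanQ.
Variable R : realType.
Implicit Types (n i m : nat).

(** Because (1 - t + t^2) (1 + t) = 1 + t^3 >= 1 and exp t >= 1 + t. *)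
Lemma expRN_le1BxDsqr (t : R) : 0 <= t -> expR (- t) <= 1 - t + t ^+ 2.
Proof.
move=> t0; have e1 := expR_ge1Dx t; rewrite expRN.
have e0 : 0 < expR t by exact: expR_gt0.
rewrite -[X in X <= _]mul1r ler_pdivrMr //.
apply: le_trans (_ : (1 - t + t ^+ 2) * (1 + t) <= _).
  have : 0 <= t ^+ 3 by exact: exprn_ge0.
  by rewrite (_ : _ * _ = 1 + t ^+ 3); [lra|ring].
by apply: ler_wpM2l => //; nra.
Qed.

Lemma half_le_1BexpRN (t : R) : 0 <= t <= 1 -> t / 2 <= 1 - expR (- t).
Proof.
move=> /andP[t0 t1]; have e1 := expR_ge1Dx t.
have e0 : 0 < expR t by exact: expR_gt0.
have E : expR t * expR (- t) = 1 by rewrite expRN mulfV // gt_eqF.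
have f0 : 0 < expR (- t) by exact: expR_gt0.
nra.
Qed.

Definition falling_ratio n i : R := \prod_(j < i) (1 - j.+1%:R / n.+1%:R).
Definition triangular_exp n i : R := expR (- ((i * i.+1)%:R / (2 * n.+1%:R))).
Definition gauss_exp n i : R := expR (- (i%:R ^+ 2 / (2 * n.+1%:R))).

Lemma falling_ratioS n i :
  falling_ratio n i.+1 = falling_ratio n i * (1 - i.+1%:R / n.+1%:R).
Proof. by rewrite /falling_ratio big_ord_recr. Qed.

Lemma triangular_expS n i :
  triangular_exp n i.+1 = triangular_exp n i * expR (- (i.+1%:R / n.+1%:R)).
Proof.
rewrite /triangular_exp -expRD; congr expR.
have N0 : n.+1%:R != 0 :> R by [].
rewrite !natrM -(natr1 i.+1) -(natr1 i).
by field.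
Qed.

Lemma falling_ratioE n i : (i <= n)%N ->
  (n ^_ i)%:R * n.+1%:R ^+ (n - i) = n.+1%:R ^+ n * falling_ratio n i :> R.
Proof.
elim: i => [|i IHi] lt.
  by rewrite /falling_ratio big_ord0 subn0 mulr1 mul1r.
rewrite falling_ratioS mulrA -IHi ?(ltnW lt) // ffactnSr natrM natrB ?(ltnW lt) //.
have -> : (n - i = (n - i.+1).+1)%N by lia.
have N0 : n.+1%:R != 0 :> R by [].
rewrite exprS; move: (n.+1%:R ^+ (n - i.+1)) => P.
move: N0; rewrite -(natr1 n) -(natr1 i) => N0.
by field.
Qed.

Lemma moment6_falling_ratio n :
  moment 6 n (1 : R) = n.+1%:R ^+ n * \sum_(i < n.+1) falling_ratio n i.
Proof.
rewrite moment6 mulr_sumr; apply: eq_bigr => i _.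
by rewrite nat1r falling_ratioE // -ltnS.
Qed.

Lemma falling_ratio_bounds n i : (i <= n.+1)%N ->
  0 <= falling_ratio n i <= triangular_exp n i.
Proof.
elim: i => [|i IHi] lt.
  by rewrite /falling_ratio big_ord0 /triangular_exp mul0n mul0r oppr0 expR0 ler01 lexx.
have /andP[q0 qe] := IHi (ltnW lt).
rewrite falling_ratioS triangular_expS.
have t1 : (i.+1%:R / n.+1%:R : R) <= 1 by rewrite ler_pdivrMr // mul1r ler_nat.
have et := expR_ge1Dx (- (i.+1%:R / n.+1%:R : R)).
move: (i.+1%:R / n.+1%:R) t1 et => t t1 et.
by apply/andP; split; [apply: mulr_ge0|apply: ler_pM] => //; lra.
Qed.

(* With the potential psi_i = 2 N / (i + sqrt N), the error d_i = e_i - q_i is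
   at most psi_i d_i - psi_(i+1) d_(i+1) + 4 (e_i - e_(i+1)), which telescopes. *)
Lemma sum_triangular_falling n :
  \sum_(i < n.+1) (triangular_exp n i - falling_ratio n i) <= 4.
Proof.
set N : R := n.+1%:R; have N0 : 0 < N by rewrite ltr0n.
set a := Num.sqrt N; have a0 : 0 < a by rewrite sqrtr_gt0.
have aN : a ^+ 2 = N by rewrite sqr_sqrtr // ltW.
pose d i := triangular_exp n i - falling_ratio n i.
pose psi i : R := 2 * N / (i%:R + a).
have psi0 i : 0 < psi i by rewrite divr_gt0 ?mulr_gt0 // ltr_wpDl.
have d0 i : (i <= n.+1)%N -> 0 <= d i.
  by move=> le; have /andP[_] := falling_ratio_bounds le; rewrite subr_ge0.
suff H m : (m <= n.+1)%N ->
    \sum_(i < m) d i <= 4 * (1 - triangular_exp n m) - psi m * d m.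
  have := H n.+1 (leqnn _); have := d0 n.+1 (leqnn _); have := psi0 n.+1.
  have : 0 < triangular_exp n n.+1 by exact: expR_gt0.
  by nra.
elim: m => [|i IHi] lt.
  rewrite big_ord0 /d /falling_ratio big_ord0 /triangular_exp mul0n mul0r oppr0.
  by rewrite expR0 !subrr !mulr0 subrr.
rewrite big_ord_recr /=; have {}IHi := IHi (ltnW lt).
have di := d0 i (ltnW lt).
suff : d i <= psi i * d i - psi i.+1 * d i.+1
    + 4 * (triangular_exp n i - triangular_exp n i.+1) by lra.
set t : R := i.+1%:R / N.
have t0 : 0 <= t by rewrite divr_ge0 // ltW.
have t1 : t <= 1 by rewrite ler_pdivrMr // mul1r ler_nat.
have Ee : triangular_exp n i.+1 = triangular_exp n i * expR (- t) by exact: triangular_expS.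
have Eq : falling_ratio n i.+1 = falling_ratio n i * (1 - t) by exact: falling_ratioS.
have e0 : 0 < triangular_exp n i by exact: expR_gt0.
have x1 := expRN_le1BxDsqr t0.
have x2 : t / 2 <= 1 - expR (- t) by apply: half_le_1BexpRN; rewrite t0.
have step1 : d i.+1 <= triangular_exp n i * t ^+ 2 + (1 - t) * d i.
  by rewrite /d Ee Eq; nra.
have step2 : triangular_exp n i * t <= 2 * (triangular_exp n i - triangular_exp n i.+1).
  by rewrite Ee; nra.
have i0 : 0 <= i%:R :> R by [].
(* As psi_(i+1) t <= 2, the quadratic error costs at most 2 e_i t <= 4 (e_i - e_(i+1)), the source
   of the constant 4. *)
have x3 : psi i.+1 * t ^+ 2 <= 2 * t.
  rewrite /psi /t -(natr1 i).
  have D0 : 0 < i%:R + 1 + a by lra.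
  have -> : 2 * N / (i%:R + 1 + a) * ((i%:R + 1) / N) ^+ 2 =
    2 * ((i%:R + 1) / N) * ((i%:R + 1) / (i%:R + 1 + a)).
    by field; rewrite !gt_eqF.
  rewrite ler_piMr //; first by rewrite mulr_ge0 // divr_ge0 //; lra.
  by rewrite ler_pdivrMr //; lra.
(* The gain psi_(i+1) t alone reaches 1 once i + 1 >= sqrt N; before that, the decrease psi_i -
   psi_(i+1) supplies the rest. *)
have x4 : 1 <= psi i - psi i.+1 * (1 - t).
  rewrite /psi /t -(natr1 i) -aN.
  have D0 : 0 < i%:R + 1 + a by lra.
  have D1 : 0 < i%:R + a by lra.
  have -> : 2 * a ^+ 2 / (i%:R + a) - 2 * a ^+ 2 / (i%:R + 1 + a) * (1 - (i%:R + 1) / a ^+ 2)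
    = 2 * (a ^+ 2 + (i%:R + 1) * (i%:R + a)) / ((i%:R + a) * (i%:R + 1 + a)).
    by field; rewrite !gt_eqF.
  rewrite ler_pdivlMr ?mulr_gt0 //; nra.
have y1 : psi i.+1 * d i.+1 <= psi i.+1 * (triangular_exp n i * t ^+ 2 + (1 - t) * d i).
  by rewrite ler_pM2l.
have y2 : triangular_exp n i * (psi i.+1 * t ^+ 2) <= triangular_exp n i * (2 * t).
  by rewrite ler_pM2l.
have y3 : d i <= (psi i - psi i.+1 * (1 - t)) * d i by rewrite ler_peMl.
lra.
Qed.

Lemma triangular_gauss n i :
  gauss_exp n i.+1 <= triangular_exp n i <= gauss_exp n i.
Proof.
rewrite /gauss_exp /triangular_exp !ler_expR !lerN2 !ler_pM2r ?invr_gt0 ?mulr_gt0 //.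
by rewrite -!natrX !ler_nat; apply/andP; split; nia.
Qed.

(** By the interlacing of [triangular_gauss], shifting the index costs at most the initial Gaussian
    term, which is 1. *)
Lemma sum_gauss_exp_triangular n :
  \sum_(i < n.+1) gauss_exp n i - 1 <= \sum_(i < n.+1) triangular_exp n i
    <= \sum_(i < n.+1) gauss_exp n i.
Proof.
apply/andP; split; last first.
  by apply: ler_sum => i _; have /andP[] := triangular_gauss n i.
rewrite lerBlDr big_ord_recl [leRHS]addrC; apply: lerD.
  by rewrite /gauss_exp expr0n mul0r oppr0 expR0.
rewrite big_ord_recr /=; apply: ler_wpDr; first exact: expR_ge0.
by apply: ler_sum => i _; have /andP[] := triangular_gauss n i.
Qed.
End RamanujanQ.

(** * The Gaussian sum as a Riemann sum of the Gaussian integral *)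

Section GaussSum.
Variable R : realType.
Implicit Types (n i m : nat) (a b x : R).
Import gauss_integral_proof.
Let mu := @lebesgue_measure R.

Lemma integrable_gauss_fun a b :
  mu.-integrable `[a, b] (EFin \o (@gauss_fun R)).
Proof.
apply: continuous_compact_integrable; first exact: segment_compact.
by apply: continuous_subspaceT; exact: continuous_gauss_fun.
Qed.

Lemma integral0_gauss_increment a b : 0 <= a -> a <= b ->
  (b - a) * gauss_fun b <= integral0_gauss b - integral0_gauss a
    <= (b - a) * gauss_fun a.
Proof.
move=> a0 ab; have b0 := le_trans a0 ab.
have g_le x y : 0 <= x -> x <= y -> gauss_fun y <= gauss_fun x :> R.
  by move=> x0 xy; rewrite ler_expR lerN2 ler_sqr ?nnegrE // (le_trans x0).
rewrite /integral0_gauss Rintegral_itvB ?bnd_simp //; last exact: integrable_gauss_fun.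
rewrite Rintegral_itv_obnd_cbnd; last first.
  by apply: integrableS (integrable_gauss_fun a b) => //; exact: subset_itv_oc_cc.
have mE : fine (mu `[a, b]) = b - a.
  rewrite /mu lebesgue_measure_itv /= lte_fin.
  by move: ab; rewrite le_eqVlt => /predU1P[->|->] //; rewrite ltxx subrr.
have cst_int (r : R) : mu.-integrable `[a, b] (EFin \o cst r).
  apply: continuous_compact_integrable; first exact: segment_compact.
  by apply: continuous_subspaceT; exact: cst_continuous.
rewrite -mE ![fine _ * _]mulrC -!Rintegral_cst //.
apply/andP; split; apply: le_Rintegral => //=; try exact: integrable_gauss_fun; try exact: cst_int.
  by move=> x; rewrite /= in_itv /= => /andP[ax xb]; apply: g_le => //; exact: le_trans ax.
by move=> x; rewrite /= in_itv /= => /andP[ax xb]; apply: g_le.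
Qed.

Lemma integral0_gauss_cvg :
  (@integral0_gauss R) x @[x --> +oo] --> Num.sqrt pi / 2.
Proof.
have : Num.sqrt (@integral0_gauss R x ^+ 2) @[x --> +oo] --> Num.sqrt (pi / 4).
  apply: continuous_cvg; [exact: sqrt_continuous|exact: cvg_integral0_gauss_sqr].
rewrite sqrtrM ?pi_ge0 // sqrtrV // (_ : 4 = 2 ^+ 2); last by rewrite -natrX.
rewrite sqrtr_sqr ger0_norm // => H.
have <- : (fun x => Num.sqrt (integral0_gauss x ^+ 2)) = @integral0_gauss R.
  by apply/funext => x; rewrite sqrtr_sqr ger0_norm // integral0_gauss_ge0.
exact: H.
Qed.

Section Scaled.
Variable n : nat.
Let N : R := n.+1%:R.
Let delta : R := (Num.sqrt (2 * N))^-1.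

Let N2_gt0 : 0 < 2 * N. Proof. by rewrite mulr_gt0 // ltr0n. Qed.
Let delta_gt0 : 0 < delta. Proof. by rewrite invr_gt0 sqrtr_gt0. Qed.

Lemma gauss_exp_fun i : gauss_exp R n i = gauss_fun (i%:R * delta).
Proof.
rewrite /gauss_exp /gauss_fun exprMn /delta exprVn sqr_sqrtr //.
exact: ltW.
Qed.

(** Right and left Riemann sums of mesh [delta] for a decreasing function; subtracting 1 removes the
    term i = 0. *)
Lemma integral0_gauss_riemann m :
  delta * (\sum_(i < m.+1) gauss_exp R n i - 1) <= integral0_gauss (m%:R * delta)
    <= delta * \sum_(i < m) gauss_exp R n i.
Proof.
elim: m => [|m /andP[IH1 IH2]].
  rewrite big_ord1 big_ord0 mul0r mulr0 /integral0_gauss set_itv1 Rintegral_set1.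
  by rewrite /gauss_exp expr0n mul0r oppr0 expR0 subrr mulr0 lexx.
have le1 : 0 <= m%:R * delta by rewrite mulr_ge0 // ltW.
have le2 : m%:R * delta <= m.+1%:R * delta by rewrite ler_pM2r // ler_nat.
have := integral0_gauss_increment le1 le2.
have -> : m.+1%:R * delta - m%:R * delta = delta by rewrite -(natr1 m); ring.
rewrite -!gauss_exp_fun => /andP[H1 H2].
move: IH1; rewrite (big_ord_recr m.+1) !(big_ord_recr m) /= => IH1.
by apply/andP; split; lra.
Qed.

Lemma integral0_gauss_cvgn :
  integral0_gauss (m%:R * delta) @[m --> \oo] --> Num.sqrt pi / 2.
Proof.
apply: (cvg_comp (fun m : nat => m%:R * delta) (@integral0_gauss R) _ integral0_gauss_cvg).
apply/cvgryPge => A; have /cvgryPge /(_ (A / delta)) := @cvgr_idn R.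
by apply: filterS => m; rewrite ler_pdivrMr.
Qed.

Lemma integral0_gauss_le m : integral0_gauss (m%:R * delta) <= Num.sqrt pi / 2.
Proof.
rewrite -(cvg_lim _ integral0_gauss_cvgn) //.
apply: (@nondecreasing_cvgn_le R (fun m => integral0_gauss (m%:R * delta))).
  apply/nondecreasing_seqP => k.
  have le1 : 0 <= k%:R * delta by rewrite mulr_ge0 // ltW.
  have le2 : k%:R * delta <= k.+1%:R * delta by rewrite ler_pM2r // ler_nat.
  have /andP[H _] := integral0_gauss_increment le1 le2.
  rewrite -subr_ge0; apply: le_trans H; rewrite mulr_ge0 ?subr_ge0 //.
  exact: gauss_fun_ge0.
by apply/cvg_ex; eexists; exact: integral0_gauss_cvgn.
Qed.

(** For i >= N one has i^2 / (2 N) >= i / 2, so the terms are at most exp (- i / 2) <= (2 / 3)^i, a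
    geometric series of sum 3. *)
Lemma sum_gauss_exp_tail m :
  \sum_(i < m) gauss_exp R n i <= \sum_(i < n.+1) gauss_exp R n i + 3.
Proof.
have ge0 i : 0 <= gauss_exp R n i by exact: expR_ge0.
have s0 : 0 <= \sum_(i < n.+1) gauss_exp R n i by apply: sumr_ge0.
pose r : R := 2 / 3; have r_gt0 : 0 < r by rewrite /r divr_gt0.
have geo k : \sum_(i < k) r ^+ i = 3 * (1 - r ^+ k).
  elim: k => [|k IHk]; first by rewrite big_ord0 subrr mulr0.
  by rewrite big_ord_recr /= IHk exprS /r; lra.
have r0 k : 0 <= r ^+ k by rewrite exprn_ge0 // ltW.
have tail i : (n < i)%N -> gauss_exp R n i <= r ^+ i.
  move=> lt.
  have h : expR (- 2^-1) <= r.
    rewrite expRN invf_ple ?posrE ?expR_gt0 //.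
    by have := expR_ge1Dx (2^-1 : R); rewrite /r; lra.
  apply: (@le_trans _ _ (expR (- 2^-1 : R) ^+ i)); last first.
    by apply: lerXn2r => //; rewrite nnegrE ?expR_ge0 // ltW.
  rewrite -expRM_natr ler_expR mulNr lerN2 mulrC.
  rewrite expr2 -mulrA ler_wpM2l // ler_pdivlMr // mulKf //.
  by rewrite ler_nat.
have [le|lt] := leqP m n.+1.
  rewrite -(subnKC le) big_split_ord /= -addrA lerDl addr_ge0 //.
  by apply: sumr_ge0.
rewrite -(subnKC (ltnW lt)) big_split_ord /= lerD2l.
apply: (@le_trans _ _ (\sum_(i < m - n.+1) r ^+ i)); last first.
  by rewrite geo; have := r0 (m - n.+1)%N; lra.
apply: ler_sum => i _; apply: le_trans (tail _ _) _; first exact: leq_addr.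
have r_le1 : r <= 1 by rewrite /r; lra.
by rewrite exprD ler_piMl // exprn_ile1 // ltW.
Qed.

(** Right sums stay below the full integral, and the term i = 0 adds 1. Left sums over ever more
    terms reach it in the limit, and the tail beyond n costs 3. *)
Lemma sum_gauss_exp_bounds :
  Num.sqrt (pi * N / 2) - 3 <= \sum_(i < n.+1) gauss_exp R n i
    <= Num.sqrt (pi * N / 2) + 1.
Proof.
have E : Num.sqrt (pi * N / 2) = Num.sqrt pi / 2 / delta.
  rewrite /delta invrK.
  have -> : pi * N / 2 = pi * (2 * N) / 2 ^+ 2 by field.
  rewrite sqrtrM ?mulr_ge0 ?pi_ge0 ?ltW // sqrtrM ?pi_ge0 // sqrtrV ?exprn_ge0 //.
  by rewrite sqrtr_sqr ger0_norm // mulrAC.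
rewrite E; apply/andP; split; last first.
  rewrite -lerBlDr ler_pdivlMr // mulrC.
  have /andP[H _] := integral0_gauss_riemann n.
  exact: le_trans H (integral0_gauss_le _).
rewrite lerBlDr ler_pdivrMr // [leRHS]mulrC.
rewrite -(cvg_lim _ integral0_gauss_cvgn) //.
apply: limr_le; first by apply/cvg_ex; eexists; exact: integral0_gauss_cvgn.
near=> m.
have /andP[_ H] := integral0_gauss_riemann m.
apply: le_trans H _; rewrite ler_pM2l //; exact: sum_gauss_exp_tail.
Unshelve. all: end_near. Qed.

End Scaled.
End GaussSum.

(** * Asymptotics *)

Section Asymptotics.
Variable R : realType.

Lemma E1_asymptotic n : (0 < n)%N ->
  `|E1 R n - Num.sqrt (pi / 2) / 2 * (n%:R * Num.sqrt n%:R)|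
    <= (3 / 2 * Num.sqrt (pi / 2) + 10) * n%:R.
Proof.
move=> n0; set k := Num.sqrt (pi / 2).
have k0 : 0 <= k by exact: sqrtr_ge0.
have n1 : 1 <= n%:R :> R by rewrite ler1n.
set Q : R := \sum_(i < n.+1) falling_ratio R n i.
have EQ : n.+1%:R * Q = 2 * E1 R n + n%:R + n.+1%:R.
  have P0 : n.+1%:R ^+ n.-1 != 0 :> R by rewrite expf_neq0.
  apply: (mulfI P0); rewrite -moment6_E1 // moment6_falling_ratio.
  by rewrite mulrA -exprSr prednK.
have /andP[g1 g2] := sum_gauss_exp_bounds R n.
have /andP[t1 t2] := sum_gauss_exp_triangular R n.
have q1 := sum_triangular_falling R n; rewrite sumrB -/Q in q1.
have q2 : Q <= \sum_(i < n.+1) triangular_exp R n i.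
  by apply: ler_sum => i _; have /andP[] := falling_ratio_bounds R (ltnW (ltn_ord i)).
set s : R := Num.sqrt n.+1%:R; set r : R := Num.sqrt n%:R.
have sE : Num.sqrt (pi * n.+1%:R / 2) = k * s.
  by rewrite mulrAC sqrtrM // divr_ge0 // pi_ge0.
rewrite sE in g1 g2.
(* The loss 8 is 3 for the tail, 1 for the interlacing and 4 for e_i - q_i. *)
have b1 : k * s - 8 <= Q by lra.
have b2 : Q <= k * s + 1 by lra.
have r0 : 0 <= r by exact: sqrtr_ge0.
have s0 : 0 <= s by exact: sqrtr_ge0.
have r2 : r ^+ 2 = n%:R by rewrite sqr_sqrtr.
have s2 : s ^+ 2 = n%:R + 1 by rewrite sqr_sqrtr // natr1.
have rs : r <= s by rewrite ler_sqrt // ler_nat.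
move: EQ b1 b2 rs s2 s0 r0 r2 n1 k0; rewrite -(natr1 n); clear.
move: s r (n%:R : R) k Q (E1 R n) => s r x k Q e.
move=> EQ b1 b2 rs s2 s0 r0 r2 x1 k0.
have x0 : 0 <= x by lra.
have sr : s <= r + 1.
  by rewrite -ler_sqr ?nnegrE //; [rewrite s2 sqrrD r2; lra | lra].
have sx : s <= x + 1.
  by rewrite -ler_sqr ?nnegrE //; [rewrite s2; nra | lra].
have d1 : x * r <= (x + 1) * s by have := ler_wpM2l x0 rs; lra.
(* Replacing (n + 1)^(3/2) by n^(3/2) costs at most 3 n. *)
have d2 : (x + 1) * s <= x * r + 3 * x by have := ler_wpM2l x0 sr; lra.
have c1 : k * (x * r) <= k * ((x + 1) * s) by rewrite ler_wpM2l.
have c2 : k * ((x + 1) * s) <= k * (x * r + 3 * x) by rewrite ler_wpM2l.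
have x10 : 0 <= x + 1 by lra.
have a1 : (x + 1) * (k * s - 8) <= (x + 1) * Q by rewrite ler_wpM2l.
have a2 : (x + 1) * Q <= (x + 1) * (k * s + 1) by rewrite ler_wpM2l.
have kx : 0 <= k * x by rewrite mulr_ge0 //; lra.
by rewrite ler_norml; apply/andP; split; lra.
Qed.

Lemma powR_9_2 n : (n%:R : R) `^ (9 / 2) = n%:R ^+ 4 * Num.sqrt n%:R.
Proof.
have -> : 9 / 2 = 4%:R + 2^-1 :> R by field.
rewrite powRD; last by apply/implyP => /eqP; lra.
by rewrite powR_mulrn // powR12_sqrt.
Qed.

Lemma area_factorial_moment3_asymptotic :
  exists2 K : R, 0 < K & forall n, (0 < n)%N ->
  `|area_factorial_moment R n 3
    - 15 / 128 * Num.sqrt (2 * pi) * n%:R `^ (9 / 2)| <= K * n%:R ^+ 4.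
Proof.
set k : R := Num.sqrt (pi / 2); pose C := 3 / 2 * k + 10.
have k0 : 0 <= k by exact: sqrtr_ge0.
have C0 : 0 <= C by rewrite /C; lra.
(* 5 bounds the polynomial part, C the error of [E1] times n^3, and 26 (k + C) the lower-degree
   factor, at most 26 n^2, times |E1| <= (k + C) n^2. *)
exists (5 + C + 26 * (k + C)) => [|n n0]; first by lra.
have kE : Num.sqrt (2 * pi) = 2 * k.
  have -> : 2 * pi = 2 ^+ 2 * (pi / 2) :> R by field.
  by rewrite sqrtrM ?exprn_ge0 // sqrtr_sqr ger0_norm.
rewrite powR_9_2 area_factorial_moment3 // kE.
have n1 : 1 <= n%:R :> R by rewrite ler1n.
have H := E1_asymptotic n0; rewrite -/k -/C in H.
set r : R := Num.sqrt n%:R in H *.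
have r0 : 0 <= r by exact: sqrtr_ge0.
have r2 : r ^+ 2 = n%:R by rewrite sqr_sqrtr.
move: H r0 r2 n1 k0 C0; clear.
move: r (n%:R : R) k C (E1 R n) => r x k C e H r0 r2 x1 k0 C0.
have rx : r <= x.
  by rewrite -ler_sqr ?nnegrE //; [rewrite r2; nra | lra].
set G := k / 2 * (x * r).
have x2 : x <= x ^+ 2 by nra.
have x2_0 : 0 <= x ^+ 2 by exact: sqr_ge0.
have G0 : 0 <= G by rewrite /G !mulr_ge0 //; lra.
have G2 : G <= k * x ^+ 2.
  have : x * r <= x ^+ 2 by nra.
  move=> xr; have : k * (x * r) <= k * x ^+ 2 by rewrite ler_wpM2l.
  have : 0 <= k * (x * r) by rewrite !mulr_ge0 //; lra.
  by rewrite /G; lra.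
have e2 : `|e| <= (k + C) * x ^+ 2.
  have -> : e = G + (e - G) by ring.
  apply: le_trans (ler_normD _ _) _; rewrite (ger0_norm G0).
  have : C * x <= C * x ^+ 2 by rewrite ler_wpM2l.
  by lra.
set A := 521 / 96 * x ^+ 2 + 1219 / 96 * x + 743 / 96.
have A0 : 0 <= A by rewrite /A; lra.
have A26 : A <= 26 * x ^+ 2 by rewrite /A; lra.
have x3 : x ^+ 2 <= x ^+ 3 by rewrite (exprS x 2); nra.
have x4 : x ^+ 3 <= x ^+ 4 by rewrite (exprS x 3); nra.
have p4 : `| - (175 / 192) * x ^+ 4 - 283 / 192 * x ^+ 3 + 199 / 192 * x ^+ 2
    + 259 / 192 * x| <= 5 * x ^+ 4.
  by rewrite ler_norml; apply/andP; split; lra.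
have p3 : `|15 / 32 * x ^+ 3 * (e - G)| <= C * x ^+ 4.
  rewrite normrM ger0_norm; last by lra.
  have x30 : 0 <= x ^+ 3 by lra.
  have : x ^+ 3 * `|e - G| <= x ^+ 3 * (C * x) by rewrite ler_wpM2l.
  have : 0 <= x ^+ 3 * `|e - G| by rewrite mulr_ge0.
  have -> : x ^+ 3 * (C * x) = C * x ^+ 4 by ring.
  by lra.
have p2 : `|A * e| <= 26 * (k + C) * x ^+ 4.
  rewrite normrM (ger0_norm A0).
  have -> : 26 * (k + C) * x ^+ 4 = (26 * x ^+ 2) * ((k + C) * x ^+ 2) by ring.
  exact: ler_pM.
have -> : - (175 / 192) * x ^+ 4 - 283 / 192 * x ^+ 3 + 199 / 192 * x ^+ 2
    + 259 / 192 * x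
    + (15 / 32 * x ^+ 3 + 521 / 96 * x ^+ 2 + 1219 / 96 * x + 743 / 96) * e
    - 15 / 128 * (2 * k) * (x ^+ 4 * r) =
    (- (175 / 192) * x ^+ 4 - 283 / 192 * x ^+ 3 + 199 / 192 * x ^+ 2
    + 259 / 192 * x) + 15 / 32 * x ^+ 3 * (e - G)
    + A * e.
  by rewrite /G /A; field.
apply: le_trans (ler_normD _ _) _; rewrite [leRHS]mulrDl.
apply: lerD p2; apply: le_trans (ler_normD _ _) _; rewrite [leRHS]mulrDl.
exact: lerD p4 p3.
Qed.

End Asymptotics.

Theorem theorem3 (R : realType) :
  (forall n : nat, (1 <= n)%N ->
     area_factorial_moment R n 3 =
       - (175 / 192) * n%:R ^+ 4 - 283 / 192 * n%:R ^+ 3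
       + 199 / 192 * n%:R ^+ 2 + 259 / 192 * n%:R
       + (15 / 32 * n%:R ^+ 3 + 521 / 96 * n%:R ^+ 2
          + 1219 / 96 * n%:R + 743 / 96) * E1 R n)
  /\
  ((fun n : nat => area_factorial_moment R n 3 : R^o) =
     (fun n : nat => 15 / 128 * Num.sqrt (2 * pi) * n%:R `^ (9 / 2) : R^o)
     +O_\oo (fun n : nat => n%:R ^+ 4 : R^o)).
Proof.
split=> [n|]; first exact: area_factorial_moment3.
apply/eqaddOP/bigO_exP.
have [K K0 HK] := area_factorial_moment3_asymptotic R.
exists K => //; exists 1%N => // n /= n0.
by rewrite (ger0_norm (_ : 0 <= n%:R ^+ 4)) ?exprn_ge0 //; exact: HK.
Qed.
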